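(* Let $M \ge 2$ be an integer, let $\mathcal A \subset \{0, \dots, M-1\}$ be nonempty, and let $\chi \in C_c^\infty((0,1);[0,1])$. Let $B_N$ be the associated quantum open baker's map and $\mathcal N_N(\nu)$ its eigenvalue counting function, and put $\delta = \frac{\log |\mathcal A|}{\log M}$. Then for each $\nu > 0$ there is a constant $C$ (independent of $N$) such that, as $N = KM \to \infty$ with $K \in \mathbb N$, $$\mathcal N_N(\nu) \le C N^\delta ,$$ i.e. $\mathcal N_N(\nu) = \mathcal O(N^\delta)$.
   Context: For $N \in \mathbb N$, $\mathbb Z_N = \mathbb Z/N\mathbb Z \simeq \{0,\dots,N-1\}$ and $\ell^2_N = \ell^2(\mathbb Z_N)$ with norm $\|u\|^2 = \sum_{j=0}^{N-1}|u(j)|^2$. The unitary discrete Fourier transform is $\mathcal F_N u(j) = N^{-1/2}\sum_{\ell=0}^{N-1} e^{-2\pi i j\ell/N} u(\ell)$. For a function $\varphi$ on $[0,1]$, its discretization $\varphi_N \in \ell^2_N$ is $\varphi_N(j) = \varphi(j/N)$, also viewed as the multiplication operator by $\varphi_N$ on $\ell^2_N$. Let $N = KM$ with $K \in \mathbb N$. For $a \in \{0,\dots,M-1\}$ define $\Pi_a : \ell^2_N \to \ell^2_K$ by $\Pi_a u(j) = u(j + aK)$, $j \in \{0,\dots,K-1\}$. The quantum open baker's map is the operator on $\ell^2_N$ $$B_N = \sum_{a \in \mathcal A} \mathcal F_N^* \Pi_a^* \chi_K \mathcal F_K \chi_K \Pi_a,$$ where $\chi_K$ is multiplication by $j \mapsto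 \chi(j/K)$ on $\ell^2_K$. For $\nu \ge 0$, $\mathcal N_N(\nu)$ is the number of eigenvalues $\lambda$ of $B_N$ with $|\lambda| \ge M^{-\nu}$, counted with multiplicity. *)

(* Defs.v *)
From mathcomp Require Import all_boot all_order all_algebra.
From mathcomp Require Import all_classical all_reals all_analysis.
From mathcomp Require Export complex.
Import GRing.Theory Num.Theory.

Set Implicit Arguments.
Unset Strict Implicit.
Unset Printing Implicit Defensive.

Local Open Scope ring_scope.

Section Baker.
Variable R : realType.
Local Notation C := (R[i]).

Definition rC (x : R) : C := Complex x 0.

Definition cexp (t : R) : C := Complex (cos t) (sin t).

Definition dft (n : nat) : 'M[C]_n :=
  \matrix_(j < n, l < n)
     (rC (Num.sqrt (n%:R))^-1 * cexp (- (2 * pi * ((j : nat) * (l : nat))%:R / n%:R))).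

Definition adjmx (m n : nat) (X : 'M[C]_(m, n)) : 'M[C]_(n, m) :=
  \matrix_(i < n, j < m) conjc (X j i).

Definition proj_a (K M : nat) (a : 'I_M) : 'M[C]_(K, K * M) :=
  \matrix_(j < K, k < K * M) (((k : nat) == (j : nat) + a * K)%N%:R).

Definition cutoff (chi : R -> R) (K : nat) : 'M[C]_K :=
  diag_mx (\row_(j < K) rC (chi ((j : nat)%:R / K%:R))).

Definition baker (M K : nat) (A : {set 'I_M}) (chi : R -> R) : 'M[C]_(K * M) :=
  \sum_(a in A)
     (adjmx (dft (K * M)) *m adjmx (proj_a K a) *m cutoff chi K *m dft K
        *m cutoff chi K *m proj_a K a).

(** eigenvalues with (algebraic) multiplicity: the roots of the characteristic
    polynomial, listed with multiplicity *)
Definition eigenvalues (n : nat) (X : 'M[C]_n) : seq C :=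
  sval (closed_field_poly_normal (char_poly X)).

Definition count_eig (M K : nat) (A : {set 'I_M}) (chi : R -> R) (nu : R) : nat :=
  count (fun z : C => rC (M%:R `^ (- nu)) <= `|z|) (eigenvalues (baker K A chi)).

(** C^infty on R (chi extended by zero outside (0,1)) *)
Definition smooth (f : R -> R) : Prop :=
  forall (n : nat) (x : R), derivable (derive1n n f) x 1.

Definition compact_support_01 (f : R -> R) : Prop :=
  exists a b : R, [/\ 0 < a, a <= b, b < 1 & forall x, x < a \/ b < x -> f x = 0].

End Baker.

(* Main.v *)
Require Import Defs.
From mathcomp Require Import all_boot all_order all_algebra.
From mathcomp Require Import all_classical all_reals all_analysis.
From mathcomp Require Import zify ring lra spectral.
Import Order.TTheory GRing.Theory Num.Theory ComplexField.Normc.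
Import numFieldNormedType.Exports.
Set Implicit Arguments.
Unset Strict Implicit.
Unset Printing Implicit Defensive.
Local Open Scope ring_scope.

(** The entry of the baker matrix at [(i, a K + l)] is a smooth exponential sum;
    summation by parts bounds it by [B_L (1 + |i - M l|)^-L] for every [L], and it
    vanishes unless [a] is in [A]. So the map moves position [x] to [M x - a] up to
    rapidly decaying tails, and multiplies the distance to the Cantor set with
    digits in [A] by [M].

    Let [D_j] be [N] times the distance from [j / N] to the Cantor set and conjugate
    the baker matrix by the diagonal matrix [(T + D_j)^s]. With [t = |i - M l|],
    the expansion [M D_j <= D_i + t] gives
    [(T + D_j) / (T + D_i) <= (1 + t / T) rho_j], [rho_j = (T + D_j) / (T + 2 D_j)],
    and [(1 + t / T)^s <= 1 + (1 + t)^s / T]. Hence once [T >= B_(s+2)] the conjugated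
    entries are at most [(B_2 + 1) rho_j^s (1 + t)^-2], with a constant that does
    not depend on [s]. As [rho_j <= 2/3] when [D_j >= T], a large [s] makes the
    conjugated matrix smaller than any prescribed constant off the set [D_j < T].

    By a unitary triangularization, each eigenvalue is [<X u, u>] for a vector [u] of
    an orthonormal basis. An eigenvalue of modulus at least [q] thus forces [u] to have
    a definite mass on [D_j < T], so that the number of such eigenvalues is [O] of the
    number of indices with [D_j < T], which is [O(|A|^k)] for [M^k <= N < M^(k+1)]. *)

(** * Moduli and conjugates of complex numbers *)

Section Complex.
Context {R : realType}.
Local Notation C := R[i].

Lemma normcE_rC (z : C) : `|z| = rC (normc z).
Proof. by []. Qed.

Lemma normc_ge0 (z : C) : 0 <= normc z.
Proof. by case: z => a b; exact: sqrtr_ge0. Qed.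

Lemma normc_sum (I : Type) (r : seq I) (P : pred I) (F : I -> C) :
  normc (\sum_(i <- r | P i) F i) <= \sum_(i <- r | P i) normc (F i).
Proof.
apply: (big_ind2 (fun x y => normc x <= y)) => //; first by rewrite normc0.
by move=> x1 x2 y1 y2 h1 h2; rewrite (le_trans (le_normcD _ _)) ?lerD.
Qed.

Lemma normc_conj (z : C) : normc (conjc z) = normc z.
Proof. by case: z => a b /=; rewrite sqrrN. Qed.

Lemma normcX (z : C) n : normc (z ^+ n) = normc z ^+ n.
Proof. by elim: n => [|n IHn]; rewrite ?expr0 ?normc1// !exprS normcM IHn. Qed.

Lemma normc_rC (x : R) : normc (rC x) = `|x|.
Proof. by rewrite /= expr0n addr0 sqrtr_sqr. Qed.

Lemma mulc_conj (z : C) : z * conjc z = rC (normc z ^+ 2).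
Proof.
case: z => a b; apply/eqP; rewrite eq_complex /= sqr_sqrtr ?addr_ge0 ?sqr_ge0//.
by apply/andP; split; apply/eqP; ring.
Qed.

Lemma rC_sum (I : Type) (r : seq I) (P : pred I) (F : I -> R) :
  rC (\sum_(i <- r | P i) F i) = \sum_(i <- r | P i) rC (F i).
Proof. exact: (rmorph_sum (real_complex R)). Qed.

Lemma rCM (x y : R) : rC (x * y) = rC x * rC y.
Proof. exact: (rmorphM (real_complex R)). Qed.

End Complex.

(** * Counting eigenvalues through a Schur test *)

Section CountingEigenvalues.
Context {R : realType}.
Local Notation C := R[i].

(** Lagrange's identity: twice the difference of the two sides is the sum of the squares of
    [x i * y j - y i * x j]. *)
Lemma cauchy_schwarz_sum (I : finType) (x y : I -> R) :
  (\sum_i x i * y i) ^+ 2 <= (\sum_i x i ^+ 2) * (\sum_i y i ^+ 2).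
Proof.
have E (a b : I -> R) : \sum_i \sum_j a i * b j = (\sum_i a i) * (\sum_i b i).
  by rewrite mulr_suml; apply: eq_bigr => i _; rewrite mulr_sumr.
have : 0 <= \sum_i \sum_j (x i * y j - y i * x j) ^+ 2.
  by apply: sumr_ge0 => i _; apply: sumr_ge0 => j _; rewrite sqr_ge0.
have -> : \sum_i \sum_j (x i * y j - y i * x j) ^+ 2 =
    \sum_i \sum_j x i ^+ 2 * y j ^+ 2
    - 2 * (\sum_i \sum_j (x i * y i) * (x j * y j))
    + \sum_i \sum_j y i ^+ 2 * x j ^+ 2.
  rewrite mulr_sumr -sumrB -big_split; apply: eq_bigr => i _ /=.
  rewrite mulr_sumr -sumrB -big_split; apply: eq_bigr => j _ /=; ring.
by rewrite !E expr2; lra.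
Qed.

Lemma weighted_cauchy_schwarz (I : finType) (g x : I -> R) :
  (forall i, 0 <= g i) ->
  (\sum_i g i * x i) ^+ 2 <= (\sum_i g i) * (\sum_i g i * x i ^+ 2).
Proof.
move=> g0.
have := cauchy_schwarz_sum (fun i => Num.sqrt (g i)) (fun i => Num.sqrt (g i) * x i).
under eq_bigr do rewrite mulrA -expr2 sqr_sqrtr//.
under [X in _ <= X * _ -> _]eq_bigr do rewrite sqr_sqrtr//.
by under [X in _ <= _ * X -> _]eq_bigr do rewrite exprMn sqr_sqrtr//.
Qed.

(** Weighted Cauchy-Schwarz in each row uses the row sums [b]; exchanging the two summations then
    brings in the column sums [a]. *)
Lemma schur_test (m n : nat) (G : 'I_m -> 'I_n -> R) (x : 'I_n -> R) (a b : R) :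
  (forall i j, 0 <= G i j) ->
  (forall j, \sum_i G i j <= a) -> (forall i, \sum_j G i j <= b) -> 0 <= b ->
  \sum_i (\sum_j G i j * x j) ^+ 2 <= a * b * \sum_j x j ^+ 2.
Proof.
move=> G0 Ga Gb b0.
have -> : a * b * \sum_j x j ^+ 2 = b * \sum_j (a * x j ^+ 2).
  by rewrite -mulr_sumr; ring.
apply: (@le_trans _ _ (\sum_i b * \sum_j G i j * x j ^+ 2)).
  apply: ler_sum => i _; apply: le_trans (weighted_cauchy_schwarz _ _) _ => //.
  by rewrite ler_wpM2r// sumr_ge0// => j _; rewrite mulr_ge0 ?sqr_ge0.
rewrite -mulr_sumr ler_wpM2l// exchange_big /=; apply: ler_sum => j _.
by rewrite -mulr_suml ler_wpM2r ?sqr_ge0.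
Qed.

Lemma char_poly_conj (F : comNzRingType) (n : nat) (P Q X : 'M[F]_n) :
  P *m Q = 1%:M -> char_poly (P *m X *m Q) = char_poly X.
Proof.
move=> PQ; rewrite /char_poly.
have -> : char_poly_mx (P *m X *m Q) =
    map_mx (@polyC F) P *m char_poly_mx X *m map_mx (@polyC F) Q.
  rewrite /char_poly_mx mulmxBr mulmxBl !map_mxM /=; congr (_ - _).
  by rewrite scalar_mxC -mulmxA -map_mxM PQ map_mx1 mulmx1.
by rewrite !det_mulmx mulrAC -det_mulmx -map_mxM PQ map_mx1 det1 mul1r.
Qed.

Lemma eigenvalues_conj (n : nat) (P Q X : 'M[C]_n) :
  P *m Q = 1%:M -> eigenvalues (P *m X *m Q) = eigenvalues X.
Proof. by move=> PQ; rewrite /eigenvalues char_poly_conj. Qed.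

Lemma eigenvalues_prod (n : nat) (X : 'M[C]_n) :
  char_poly X = \prod_(z <- eigenvalues X) ('X - z%:P).
Proof.
rewrite /eigenvalues; case: closed_field_poly_normal => s /= {1}->.
by rewrite (monicP (char_poly_monic X)) scale1r.
Qed.

(** The characteristic polynomial splits over the diagonal entries, and a factorization into monic
    linear factors is unique up to permutation. *)
Lemma count_eigenvalues_trig (n : nat) (X : 'M[C]_n) (p : pred C) :
  is_trig_mx X -> count p (eigenvalues X) = #|[set i | p (X i i)]|.
Proof.
move=> trX; have := eigenvalues_prod X; rewrite (char_poly_trig trX).
rewrite -(big_map (fun i => X i i) predT (fun z => 'X - z%:P)) => /prod_XsubC_eq.
move=> /permP <-; rewrite count_map cardE /enum_mem size_filter.
by apply: eq_count => i /=; rewrite inE.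
Qed.

Local Open Scope sesquilinear_scope.

Lemma unitarymx_row_norm (n : nat) (P : 'M[C]_n) (i : 'I_n) :
  P \is unitarymx -> \sum_j normc (P i j) ^+ 2 = 1.
Proof.
move=> /unitarymxP /matrixP/(_ i i); rewrite !mxE eqxx => PP.
have /(congr1 (@complex.Re R)) /= <- : \sum_j rC (normc (P i j) ^+ 2) = 1.
  by rewrite -[RHS]PP; apply: eq_bigr => j _; rewrite !mxE -mulc_conj.
by rewrite -rC_sum.
Qed.

Lemma unitarymx_col_norm (n : nat) (P : 'M[C]_n) (j : 'I_n) :
  P \is unitarymx -> \sum_i normc (P i j) ^+ 2 = 1.
Proof.
rewrite -trmx_unitary => /unitarymx_row_norm => /(_ j) <-.
by apply: eq_bigr => i _; rewrite mxE.
Qed.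

(** The diagonal entry is an inner product of [X u] with the unit vector [u], the [i]-th column of
    the adjoint of [P]. Cauchy-Schwarz leaves the squared norm of [X u], estimated through moduli of
    entries. *)
Lemma unitary_conj_diag_le (n : nat) (P X : 'M[C]_n) (i : 'I_n) :
  P \is unitarymx ->
  normc ((P *m X *m P^t*) i i) ^+ 2 <=
    \sum_k (\sum_j normc (X k j) * normc (P i j)) ^+ 2.
Proof.
move=> uP; rewrite -mulmxA mxE.
set v := X *m _.
have nv k : normc (v k i) <= \sum_j normc (X k j) * normc (P i j).
  rewrite mxE; apply: le_trans (normc_sum _ _ _) _.
  by apply: ler_sum => j _; rewrite normcM !mxE normc_conj.
apply: (@le_trans _ _ ((\sum_j normc (P i j) * normc (v j i)) ^+ 2)).
  rewrite lerXn2r ?nnegrE ?normc_ge0 ?sumr_ge0//.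
    by move=> j _; rewrite mulr_ge0 ?normc_ge0.
  apply: le_trans (normc_sum _ _ _) _.
  by apply: ler_sum => j _; rewrite normcM.
apply: (@le_trans _ _ (\sum_j normc (v j i) ^+ 2)); last first.
  apply: ler_sum => k _; rewrite lerXn2r ?nnegrE ?normc_ge0 ?sumr_ge0//.
  by move=> j _; rewrite mulr_ge0 ?normc_ge0.
apply: le_trans (cauchy_schwarz_sum _ _) _.
by rewrite unitarymx_row_norm// mul1r.
Qed.

Lemma count_eigenvalues_le (n : nat) (X : 'M[C]_n) (G : 'I_n -> 'I_n -> R)
    (r : 'I_n -> R) (D : {set 'I_n}) (a b q : R) :
  (forall k j, 0 <= G k j) -> (forall k j, normc (X k j) <= G k j * r j) ->
  (forall j, \sum_k G k j <= a) -> (forall k, \sum_j G k j <= b) ->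
  0 <= a -> 0 <= b ->
  (forall j, 0 <= r j <= 1) ->
  (forall j, j \notin D -> a * b * r j ^+ 2 <= q ^+ 2 / 2) -> 0 <= q ->
  (count (fun z : C => rC q <= `|z|) (eigenvalues X))%:R * (q ^+ 2 / 2)
    <= a * b * #|D|%:R.
Proof.
move=> G0 XG Ga Gb a0 b0 r01 rD q0.
have [P uP trP] : exists2 P : 'M[C]_n,
    P \is unitarymx & is_trig_mx (P *m X *m P^t*).
  have [] := @cotrigonalization _ _ [:: X].
    by move=> ? ?; rewrite !inE => /eqP-> /eqP->.
  move=> P uP /allP /(_ X (mem_head _ _)) trP; exists P; first exact: uP.
  rewrite -conjymx; [exact: trP|exact: uP].
have PP : P *m P^t* = 1%:M by exact: (unitarymxP uP).
rewrite -(eigenvalues_conj X PP) (count_eigenvalues_trig _ trP).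
set E := [set _ | _].
have key i : i \in E -> q ^+ 2 / 2 <= a * b * \sum_(j in D) normc (P i j) ^+ 2.
  rewrite inE normcE_rC lecR => qi.
  have : q ^+ 2 <= a * b * \sum_j (r j * normc (P i j)) ^+ 2.
    apply: (@le_trans _ _ (normc ((P *m X *m P^t*) i i) ^+ 2)).
      by rewrite lerXn2r ?nnegrE ?normc_ge0.
    apply: le_trans (unitary_conj_diag_le _ _ uP) _.
    apply: (@le_trans _ _ (\sum_k (\sum_j G k j * (r j * normc (P i j))) ^+ 2)).
      apply: ler_sum => k _; rewrite lerXn2r ?nnegrE ?sumr_ge0//.
      - by move=> j _; rewrite mulr_ge0 ?normc_ge0.
      - move=> j _; rewrite mulr_ge0// mulr_ge0 ?normc_ge0//.
        by case/andP: (r01 j).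
      - apply: ler_sum => j _; rewrite mulrA ler_wpM2r ?normc_ge0//.
    exact: schur_test.
  (* Off [D] the factor [r j] is small and row [i] of [P] has norm 1, so this part is at most half
     of [q ^+ 2]; the mass on [D] must supply the other half. *)
  have -> : a * b * \sum_j (r j * normc (P i j)) ^+ 2 =
      a * b * \sum_(j in D) (r j * normc (P i j)) ^+ 2
      + \sum_(j in ~: D) a * b * r j ^+ 2 * normc (P i j) ^+ 2.
    rewrite (bigID [in D]) /= mulrDr; congr (_ + _).
    rewrite mulr_sumr; apply: eq_big => [j|j _]; first by rewrite inE.
    by rewrite exprMn mulrA.
  have h1 : a * b * \sum_(j in D) (r j * normc (P i j)) ^+ 2 <=
      a * b * \sum_(j in D) normc (P i j) ^+ 2.
    rewrite ler_wpM2l ?mulr_ge0//; apply: ler_sum => j _.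
    rewrite exprMn ler_piMl ?sqr_ge0// expr_le1//; by case/andP: (r01 j).
  have h2 : \sum_(j in ~: D) a * b * r j ^+ 2 * normc (P i j) ^+ 2 <= q ^+ 2 / 2.
    have -> : q ^+ 2 / 2 = \sum_j q ^+ 2 / 2 * normc (P i j) ^+ 2.
      by rewrite -mulr_sumr unitarymx_row_norm// mulr1.
    rewrite [leRHS](bigID [in ~: D]) /= ler_wpDr//.
      by apply: sumr_ge0 => j _; rewrite mulr_ge0 ?sqr_ge0// divr_ge0 ?sqr_ge0.
    apply: ler_sum => j; rewrite inE => jD; rewrite ler_wpM2r ?sqr_ge0 ?rD//.
  lra.
(* Summed over [E], the masses on [D] total at most [#|D|], because each column of [P] has norm
   1. *)
apply: (@le_trans _ _ (\sum_(i in E) a * b * \sum_(j in D) normc (P i j) ^+ 2)).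
  by rewrite -sumr_const mulr_suml; apply: ler_sum => i iE; rewrite mul1r key.
rewrite -mulr_sumr ler_wpM2l ?mulr_ge0// exchange_big -sumr_const /=.
apply: ler_sum => j _; rewrite -(unitarymx_col_norm j uP).
by rewrite [leRHS](bigID [in E]) /= ler_wpDr// sumr_ge0// => i _; rewrite sqr_ge0.
Qed.

End CountingEigenvalues.

(** * Finite differences of smooth functions *)

Section Smooth.
Local Open Scope classical_set_scope.
Context {R : realType}.
Implicit Types f g : R -> R.

(** Backward differences are what multiplying an exponential sum by [1 - z] produces. *)
Definition bdiff (h : R) (f : R -> R) : R -> R := fun x => f x - f (x - h).

Lemma is_derive_bdiff (h : R) f (x : R) : derivable f x 1 -> derivable f (x - h) 1 ->
  is_derive x 1 (bdiff h f) (bdiff h (derive1 f) x).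
Proof.
move=> df dfh; rewrite /bdiff !derive1E.
have d1 : is_derive x 1 f ('D_1 f x) by exact/derivableP.
have d2 : is_derive (x - h) 1 f ('D_1 f (x - h)) by exact/derivableP.
have d3 : is_derive x 1 (fun y => y - h) 1.
  by apply: is_derive_eq; rewrite subr0.
have d4 := @is_derive1_comp R f (fun y => y - h) x _ _ d2 d3.
rewrite mulr1 in d4; exact: is_deriveB.
Qed.

Lemma derive1n_bdiff h f n : smooth f ->
  derive1n n (bdiff h f) = bdiff h (derive1n n f).
Proof.
move=> sf; elim: n => [//|n IHn]; rewrite !derive1nS IHn.
apply/funext => x; rewrite derive1E.
exact: (@derive_val _ _ _ _ _ _ _ (is_derive_bdiff (sf n _) (sf n _))).
Qed.

Lemma smooth_bdiff h f : smooth f -> smooth (bdiff h f).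
Proof.
move=> sf n x; rewrite derive1n_bdiff//.
by have [] := is_derive_bdiff (sf n x) (sf n (x - h)).
Qed.

Lemma bdiff_le h f c : 0 <= h -> (forall x, derivable f x 1) ->
  (forall x, `|derive1 f x| <= c) -> forall x, `|bdiff h f x| <= c * h.
Proof.
move=> h0 df fc x.
have [|||y _ e] := @MVT_segment R f (derive1 f) (x - h) x.
- by rewrite lerBlDr lerDl.
- by move=> y _; rewrite derive1E; exact/derivableP.
- by apply: derivable_within_continuous => y _; exact: df.
- by rewrite /bdiff e opprB addrC subrK normrM (ger0_norm h0) ler_wpM2r.
Qed.

(** By the mean value theorem each difference costs one derivative and gains a factor [h];
    differences commute with derivatives. *)
Lemma iter_bdiff_le h f c n : 0 <= h -> smooth f ->
  (forall x, `|derive1n n f x| <= c) ->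
  forall x, `|iter n (bdiff h) f x| <= c * h ^+ n.
Proof.
move=> h0; elim: n f c => [|n IHn] f c sf fc x; first by rewrite expr0 mulr1 fc.
rewrite iterSr exprS mulrA; apply: IHn; first exact: smooth_bdiff.
move=> y; rewrite derive1n_bdiff//; exact: bdiff_le.
Qed.

Lemma derive1_vanish f a b : (forall x, x < a \/ b < x -> f x = 0) ->
  forall x, x < a \/ b < x -> derive1 f x = 0.
Proof.
move=> f0 x hx; rewrite derive1E (@near_eq_derive _ _ _ _ (cst 0)).
  exact: derive_cst.
case: hx => hx.
  by near=> y; apply: f0; left; near: y; exact: lt_nbhsl.
by near=> y; apply: f0; right; near: y; exact: lt_nbhsr.
Unshelve. all: by end_near. Qed.

Lemma smooth_derive1n_bounded f a b n : smooth f -> a <= b ->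
  (forall x, x < a \/ b < x -> f x = 0) ->
  exists c, forall x, `|derive1n n f x| <= c.
Proof.
move=> sf ab f0.
have g0 : forall x, x < a \/ b < x -> derive1n n f x = 0.
  by elim: n => [//|n IHn]; rewrite derive1nS; exact: derive1_vanish.
set g := derive1n n f in g0 *.
have cg : {within `[a, b], continuous g}.
  by apply: derivable_within_continuous => y _; exact: sf.
have [c _ hc] := EVT_max ab cg.
have [d _ hd] := EVT_min ab cg.
exists (`|g c| + `|g d|) => x.
have [xab|] := boolP (x \in `[a, b]%R).
  have := hc x xab; have := hd x xab; move: (g c) (g d) (g x) => u v w ? ?.
  have := ler_norm u; have := ler_norm (- v); rewrite normrN => ? ?.
  rewrite ler_norml; apply/andP;
    split; have := normr_ge0 u; have := normr_ge0 v; lra.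
rewrite in_itv /= negb_and -!ltNge => /orP hx; rewrite g0// normr0 addr_ge0//.
Qed.

Lemma bdiff_vanish h f b : 0 <= h -> (forall x, x <= 0 \/ b <= x -> f x = 0) ->
  forall x, x <= 0 \/ b + h <= x -> bdiff h f x = 0.
Proof. by move=> h0 f0 x hx; rewrite /bdiff !f0 ?subrr//; lra. Qed.

End Smooth.

(** * Decay of smooth exponential sums *)

Section ExponentialSums.
Local Open Scope classical_set_scope.
Context {R : realType}.
Implicit Types (g : R -> R) (z : R[i]).

(** Summation by parts; the boundary values [g (n h)] and [g (- h)] vanish. *)
Lemma exp_sum_bdiff (h : R) g z n :
  (forall x, x <= 0 \/ n%:R * h <= x -> g x = 0) -> 0 <= h ->
  (1 - z) * (\sum_(m < n.+1) rC (g (m%:R * h)) * z ^+ m) =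
  \sum_(m < n.+1) rC (bdiff h g (m%:R * h)) * z ^+ m.
Proof.
move=> g0 h0.
have rCB (x y : R) : rC (x - y) = rC x - rC y by exact: (rmorphB (real_complex R)).
rewrite mulrBl mul1r /bdiff.
under [RHS]eq_bigr do rewrite rCB mulrBl.
rewrite sumrB; congr (_ - _).
rewrite [RHS]big_ord_recl [in LHS]big_ord_recr /= [in LHS]g0; last by right.
rewrite [in RHS]g0; last by left; rewrite mul0r sub0r oppr_le0.
rewrite !mul0r addr0 add0r mulr_sumr; apply: eq_bigr => m _.
rewrite /bump leq0n add1n -natr1 mulrDl mul1r addrK exprS; ring.
Qed.

(** Each difference enlarges the support by [h], hence the [L] additional terms of the sum. *)
Lemma exp_sum_iter_bdiff (h : R) g z n L :
  (forall x, x <= 0 \/ n%:R * h <= x -> g x = 0) -> 0 <= h ->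
  (1 - z) ^+ L * (\sum_(m < (n + L).+1) rC (g (m%:R * h)) * z ^+ m) =
  \sum_(m < (n + L).+1) rC (iter L (bdiff h) g (m%:R * h)) * z ^+ m.
Proof.
move=> + h0; elim: L n g => [|L IHL] n g g0; first by rewrite expr0 mul1r.
rewrite exprSr -mulrA exp_sum_bdiff//; last first.
  move=> x [x0|nx]; apply: g0; [by left|right; apply: le_trans nx].
  by rewrite ler_wpM2r// ler_nat leq_addr.
rewrite iterSr addnS -addSn IHL// => x hx; apply: (bdiff_vanish h0 g0).
by rewrite -natr1 mulrDl mul1r in hx.
Qed.

Lemma normc_1Bcexp (t : R) : normc (1 - cexp t) = 2 * `|sin (t / 2)|.
Proof.
have -> : 2 * `|sin (t / 2)| = Num.sqrt ((2 * sin (t / 2)) ^+ 2).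
  by rewrite sqrtr_sqr normrM ger0_norm.
have ct : cos t = 1 - 2 * sin (t / 2) ^+ 2.
  rewrite -[in LHS](@divfK _ 2 _ t) ?pnatr_eq0// mulr_natr cos_mulr2n sin2cos2.
  by rewrite -mulr_natr; ring.
rewrite /normc /=; congr Num.sqrt; have := cos2Dsin2 t.
rewrite sub0r sqrrN sqrrB expr1n mul1r exprMn -mulr_natr => e.
have -> : 1 - cos t * 2 + cos t ^+ 2 + sin t ^+ 2 = 2 - cos t * 2 by lra.
by rewrite ct; ring.
Qed.

Lemma normc_cexp (t : R) : normc (cexp t) = 1.
Proof. by rewrite /= cos2Dsin2 sqrtr1. Qed.

(** Halve the angle and apply the mean value theorem to [sin (x / 2)]: both cosines that appear are
    at least [cos (b / 2)], as cosine decreases on [[0, pi]]. *)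
Lemma sin_ge_lin (x b : R) : 0 <= x <= b -> b <= pi ->
  x * cos (b / 2) ^+ 2 <= sin x.
Proof.
move=> /andP[x0 xb] bpi; have p0 := pi_gt0 R.
have cle (u v : R) : 0 <= u -> u <= v -> v <= pi -> cos v <= cos u.
  move=> u0 uv vpi; have [->//|neq] := eqVneq u v.
  apply/ltW; rewrite ltr_cos ?in_itv/= ?u0 ?vpi ?(le_trans uv) ?(le_trans u0)//.
  by rewrite lt_neqAle neq.
have [|| c] := @MVT_segment R (@sin R) (@cos R) 0 (x / 2).
- by rewrite divr_ge0.
- by apply: continuous_subspaceT; exact: continuous_sin.
rewrite in_itv /= sin0 !subr0 => /andP[c0 cx] e.
have sx : sin x = 2 * (cos (x / 2) * (cos c * (x / 2))).
  by rewrite -[in LHS](@divfK _ 2 _ x) ?pnatr_eq0// mulr_natr sin_mulr2n e -mulr_natl.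
have b0 : 0 <= cos (b / 2) by apply: cos_ge0_pihalf; apply/andP; split; lra.
have h1 : cos (b / 2) <= cos (x / 2) by apply: cle; lra.
have h2 : cos (b / 2) <= cos c by apply: cle; lra.
have -> : sin x = x * (cos (x / 2) * cos c) by rewrite sx; field.
by rewrite ler_wpM2l// expr2 ler_pM.
Qed.

(** With [N = K M], summing by parts [L] times gains [K ^- L] and loses [|1 - z| ^- L]. The bound on
    [|t|] keeps [t] away from the zeros [N] and [- N] of [1 - z], so [|1 - z|] is at least a
    multiple of [|t| / N] and the powers of [K] cancel. *)
Lemma exp_sum_decay (chi : R -> R) (M : nat) (c : R) (L : nat) :
  smooth chi -> compact_support_01 chi -> (0 < M)%N -> 0 < c < 1 ->
  exists2 B : R, 0 <= B & forall (K : nat) (t : R), (0 < K)%N ->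
    `|t| <= (1 - c) * (K * M)%:R ->
    normc (\sum_(m < K) rC (chi (m%:R / K%:R)) * cexp (2 * pi * t / (K * M)%:R) ^+ m)
      * (1 + `|t|) ^+ L <= B * K%:R.
Proof.
move=> schi [a [b [a0 ab b1 chi0]]] M0 /andP[c0 c1].
have [B0 hB0] := smooth_derive1n_bounded 0 schi ab chi0.
have [B1 hB1] := smooth_derive1n_bounded L schi ab chi0.
have B00 : 0 <= B0 by apply: le_trans (hB0 0).
have B10 : 0 <= B1 by apply: le_trans (hB1 0).
have p0 := pi_gt0 R.
pose k : R := 2 * (pi * cos ((1 - c) * pi / 2) ^+ 2).
have k0 : 0 < k.
  rewrite /k mulr_gt0// mulr_gt0// exprn_gt0//; apply: cos_gt0_pihalf.
  by apply/andP; split; nra.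
have MR : 0 < M%:R :> R by rewrite ltr0n.
pose Q := M%:R ^+ L * (L%:R + 2) * B1 / k ^+ L.
have rest : 0 <= Q.
  apply: divr_ge0; last exact/exprn_ge0/ltW.
  by rewrite mulr_ge0// mulr_ge0 ?exprn_ge0// addr_ge0.
exists (2 ^+ L * (B0 + Q)).
  by rewrite mulr_ge0 ?exprn_ge0// addr_ge0.
move=> K t K0 tle.
have KR : 0 < K%:R :> R by rewrite ltr0n.
set N : R := (K * M)%:R in tle *.
have NR : 0 < N by rewrite ltr0n muln_gt0 K0.
have NE : N = K%:R * M%:R by rewrite /N natrM.
clearbody N; set z := cexp _; set S := \sum_(m < K) _.
have nz m : normc (z ^+ m) = 1 by rewrite normcX normc_cexp expr1n.
have S_le : normc S <= B0 * K%:R.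
  apply: le_trans (normc_sum _ _ _) _.
  apply: (@le_trans _ _ (\sum_(m < K) B0)).
    by apply: ler_sum => m _; rewrite normcM nz mulr1 normc_rC; exact: hB0.
  by rewrite sumr_const card_ord mulr_natr.
(* For [|t| < 1] the trivial bound on the sum suffices, since the weight is at most [2 ^+ L]. *)
have [t1|t1] := ltP `|t| 1.
  rewrite -mulrA mulrC; apply: ler_pM.
  - by rewrite exprn_ge0// addr_ge0.
  - exact: normc_ge0.
  - by rewrite lerXn2r ?nnegrE ?addr_ge0// -[leRHS](natrD R 1 1) lerD2l ltW.
  by apply: le_trans S_le _; rewrite ler_wpM2r ?ler0n// lerDl.
have zt : k * `|t| <= N * normc (1 - z).
  rewrite /z normc_1Bcexp.
  have -> : 2 * pi * t / N / 2 = pi * t / N. by field; rewrite gt_eqF.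
  have -> : `|sin (pi * t / N)| = `|sin (pi * `|t| / N)|.
    have [tp|tn] := ger0P t; first by [].
    by rewrite mulrN mulNr sinN normrN.
  have := @sin_ge_lin (pi * `|t| / N) ((1 - c) * pi) _ _.
  have h : 0 <= pi * `|t| / N <= (1 - c) * pi.
    apply/andP; split; first by rewrite divr_ge0 ?mulr_ge0// ltW.
    rewrite ler_pdivrMr// [(1 - c) * pi]mulrC -mulrA ler_pM2l//.
  move=> /(_ h) hs; have {}hs := hs ltac:(nra).
  apply: (@le_trans _ _ (N * (2 * sin (pi * `|t| / N)))); last first.
    by rewrite ler_pM2l// ler_pM2l// ler_norm.
  have -> : k * `|t| = N * (2 * (pi * `|t| / N * cos ((1 - c) * pi / 2) ^+ 2)).
    by rewrite /k; field; rewrite gt_eqF.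
  by rewrite ler_pM2l// ler_pM2l.
(* The terms with [m >= K] vanish by the support of [chi]; they make room for the growing support of
   the differences. *)
have SE : \sum_(m < (K + L).+1) rC (chi (m%:R * K%:R^-1)) * z ^+ m = S.
  rewrite /S -(big_mkord xpredT (fun m => rC (chi (m%:R / K%:R)) * z ^+ m)).
  rewrite (@big_cat_nat _ _ _ K) //= ?ltnS ?leq_addr//;
    last by rewrite ltnW// ltnS leq_addr.
  rewrite big_mkord [X in _ + X]big_nat [X in _ + X]big1 ?addr0// => m /andP[Km _].
  rewrite chi0 ?mul0r//; right; apply: lt_le_trans b1 _.
  by rewrite ler_pdivlMr// mul1r ler_nat.
have parts : normc (1 - z) ^+ L * normc S <= (K + L).+1%:R * (B1 * K%:R^-1 ^+ L).
  rewrite -normcX -normcM -SE exp_sum_iter_bdiff ?invr_ge0 ?ler0n//; last first.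
    move=> x hx; apply: chi0; rewrite divff ?gt_eqF// in hx; lra.
  apply: le_trans (normc_sum _ _ _) _.
  apply: (@le_trans _ _ (\sum_(m < (K + L).+1) B1 * K%:R^-1 ^+ L)).
    apply: ler_sum => m _; rewrite normcM nz mulr1 normc_rC.
    by apply: iter_bdiff_le => //; rewrite invr_ge0.
  by rewrite sumr_const card_ord mulr_natl.
have step : k ^+ L * (`|t| ^+ L * normc S) <= M%:R ^+ L * ((K + L).+1%:R * B1).
  have -> : M%:R ^+ L * ((K + L).+1%:R * B1) =
      N ^+ L * ((K + L).+1%:R * (B1 * K%:R^-1 ^+ L)).
    by rewrite NE exprMn exprVn; field; rewrite expf_neq0// gt_eqF.
  apply: (@le_trans _ _ (N ^+ L * (normc (1 - z) ^+ L * normc S))); last first.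
    by rewrite ler_pM2l// exprn_gt0.
  rewrite !mulrA -!exprMn ler_wpM2r ?normc_ge0// lerXn2r// nnegrE mulr_ge0//.
  - exact: ltW.
  - exact: ltW.
  - exact: normc_ge0.
have KL : (K + L).+1%:R <= (L%:R + 2) * K%:R :> R.
  have -> : L%:R + 2 = (L + 2)%:R :> R by rewrite natrD.
  rewrite -natrM ler_nat mulnDl mul2n -addnn addnA -addnS [(K + L.+1)%N]addnC.
  by rewrite leq_add2r -addn1 leq_add ?leq_pmulr.
have {}step : `|t| ^+ L * normc S <= Q * K%:R.
  rewrite -(ler_pM2l (exprn_gt0 L k0)); apply: le_trans step _.
  have -> : k ^+ L * (Q * K%:R) =
     M%:R ^+ L * ((L%:R + 2) * K%:R * B1).
    by rewrite /Q; field; rewrite expf_neq0// gt_eqF.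
  by rewrite ler_pM2l ?exprn_gt0// ler_wpM2r.
apply: (@le_trans _ _ (2 ^+ L * (`|t| ^+ L * normc S))).
  rewrite mulrA -exprMn mulrC ler_wpM2r ?normc_ge0// lerXn2r ?nnegrE ?addr_ge0//; lra.
rewrite -mulrA ler_pM2l ?exprn_gt0//; apply: le_trans step _.
by rewrite ler_wpM2r ?ler0n// lerDr.
Qed.

End ExponentialSums.

(** * The Cantor set with digits in [A] *)

Section CantorSet.
Local Open Scope classical_set_scope.
Context {R : realType} (M : nat) (A : {set 'I_M}).
Hypothesis M2 : (2 <= M)%N.
Hypothesis A0 : (0 < #|A|)%N.

(** These are the left endpoints of the level-[k] intervals, each of length [M ^- k]. *)
Fixpoint cantor_points (k : nat) : seq R :=
  if k is k'.+1 then
    [seq (a%:R + y) / M%:R | a : 'I_M <- enum A, y <- cantor_points k']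
  else [:: 0].

Lemma size_cantor_points k : size (cantor_points k) = (#|A| ^ k)%N.
Proof. by elim: k => [//|k IHk]; rewrite /= size_allpairs IHk -cardE expnS. Qed.

Definition cantor_set : set R := [set z | forall k,
  exists2 y, y \in cantor_points k & y <= z <= y + M%:R ^- k].

Let M0 : 0 < M%:R :> R. Proof. by rewrite ltr0n; lia. Qed.

Lemma cantor_level_shift (a : 'I_M) (z : R) k : a \in A ->
  (exists2 y, y \in cantor_points k & y <= z <= y + M%:R ^- k) ->
  exists2 y, y \in cantor_points k.+1 &
    y <= (a%:R + z) / M%:R <= y + M%:R ^- k.+1.
Proof.
move=> aA [y yk /andP[yz zy]]; exists ((a%:R + y) / M%:R).
  by apply/allpairsP; exists (a, y); split; rewrite ?mem_enum.
have -> : (a%:R + y) / M%:R + M%:R ^- k.+1 = (a%:R + (y + M%:R ^- k)) / M%:R.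
  by rewrite exprS invfM; ring.
by rewrite !ler_pM2r ?invr_gt0// !lerD2l yz.
Qed.

Lemma cantor_set_shift (a : 'I_M) z : a \in A ->
  cantor_set z -> cantor_set ((a%:R + z) / M%:R).
Proof.
move=> aA zC [|k]; last exact/cantor_level_shift.
have [y] := zC 0%N; rewrite inE => /eqP -> /andP[z0].
rewrite expr0 invr1 add0r => z1; exists 0; first exact: mem_head.
rewrite add0r.
rewrite divr_ge0 ?addr_ge0//= ler_pdivrMr// mul1r.
have : a%:R + 1 <= M%:R :> R by rewrite natr1 ler_nat.
lra.
Qed.

Lemma cantor_set_nonempty : cantor_set !=set0.
Proof.
have [a aA] : exists a, a \in A by apply/card_gt0P.
have M1 : 0 < M%:R - 1 :> R by rewrite subr_gt0 ltr1n.
have fixz : (a%:R + a%:R / (M%:R - 1)) / M%:R = a%:R / (M%:R - 1) :> R.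
  by field; rewrite !gt_eqF.
(* This is the fixed point of the contraction with digit [a], the number all of whose base-[M]
   digits equal [a]. *)
exists (a%:R / (M%:R - 1)); elim => [|k IHk]; last first.
  by rewrite -fixz; exact: cantor_level_shift.
exists 0; first exact: mem_head.
rewrite expr0 invr1 add0r divr_ge0 ?(ltW M1)//=.
rewrite ler_pdivrMr// mul1r lerBrDr natr1 ler_nat; exact: ltn_ord.
Qed.

Definition cantor_dist (x : R) : R := inf [set `|x - z| | z in cantor_set].

Let has_lb x : has_lbound [set `|x - z| | z in cantor_set].
Proof. by exists 0 => _ [z _ <-]. Qed.

Let nonempty_dist x : [set `|x - z| | z in cantor_set] !=set0.
Proof. by have [z zC] := cantor_set_nonempty; exists `|x - z|, z. Qed.

Lemma cantor_dist_le x z : cantor_set z -> cantor_dist x <= `|x - z|.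
Proof. by move=> zC; apply: ge_inf => //; exists z. Qed.

Lemma cantor_dist_ge0 x : 0 <= cantor_dist x.
Proof. by apply: lb_le_inf => // _ [z _ <-]. Qed.

Lemma cantor_dist_lip x y : cantor_dist x <= cantor_dist y + `|x - y|.
Proof.
rewrite -lerBlDr; apply: lb_le_inf => // _ [z zC <-].
rewrite lerBlDr; apply: le_trans (cantor_dist_le _ zC) _.
by rewrite [leRHS]addrC; exact: ler_distD.
Qed.

(** The contraction with digit [a] maps the Cantor set into itself and divides distances by [M]. *)
Lemma cantor_dist_shift (a : 'I_M) x : a \in A ->
  M%:R * cantor_dist ((a%:R + x) / M%:R) <= cantor_dist x.
Proof.
move=> aA; apply: lb_le_inf => // _ [z zC <-].
rewrite mulrC -ler_pdivlMr//.
apply: le_trans (cantor_dist_le _ (cantor_set_shift aA zC)) _.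
have -> : (a%:R + x) / M%:R - (a%:R + z) / M%:R = (x - z) / M%:R by ring.
by rewrite normrM normfV (gtr0_norm M0).
Qed.

Lemma cantor_dist_near_points x e k : cantor_dist x < e ->
  exists2 y, y \in cantor_points k & `|x - y| < e + M%:R ^- k.
Proof.
rewrite -subr_gt0 => /inf_adherent /(_ (conj (nonempty_dist x) (has_lb x))).
rewrite addrC subrK => -[_ [z zC <-]] xz.
have [y yk /andP[yz zy]] := zC k; exists y => //.
rewrite -[x - y](subrKA z); apply: le_lt_trans (ler_normD _ _) _.
by rewrite ltr_leD// ger0_norm ?subr_ge0// lerBlDl.
Qed.

(** All these indices lie among the [truncn (2 T) + 1] consecutive integers starting at the least
    one. *)
Lemma card_ord_near (N : nat) (c T : R) : 0 <= T ->
  #|[set j : 'I_N | `|j%:R - c| < T]%SET|%:R <= 2 * T + 1.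
Proof.
move=> T0; set E := [set _ | _]%SET.
have [->|[i iE]] := set_0Vmem E; first by rewrite cards0; lra.
have [i0 i0E imin] := arg_minnP (fun j : 'I_N => j : nat) iE.
have w0 : 0 <= 2 * T by lra.
have /andP[wle wlt] := truncn_itv w0.
apply: (@le_trans _ _ (Num.truncn (2 * T)).+1%:R); last by rewrite -natr1 lerD2r.
rewrite ler_nat cardE -(size_map val) -(size_iota i0 (Num.truncn (2 * T)).+1).
apply: uniq_leq_size; first by rewrite map_inj_uniq ?enum_uniq//; exact: val_inj.
move=> x /mapP[j]; rewrite mem_enum => jE ->; rewrite mem_iota imin//= addnS ltnS.
rewrite -leq_subLR -ltnS -(ltr_nat R); apply: le_lt_trans wlt.
rewrite natrB ?imin//; have {}i0E : i0 \in E by [].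
move: i0E jE; rewrite !inE !ltr_norml.
by move=> /andP[? ?] /andP[? ?]; lra.
Qed.

(** At level [k] with [M ^ k <= N < M ^ k.+1], intervals rescaled by [N] have length at most [M]. So
    each such [j] is within [T + M] of [N y] for one of the [#|A| ^ k] endpoints [y]. *)
Lemma card_cantor_neighborhood (N : nat) (T : R) : (0 < N)%N -> 0 <= T ->
  #|[set j : 'I_N | N%:R * cantor_dist (j%:R / N%:R) < T]%SET|%:R
    <= (2 * (T + M%:R) + 1) * (#|A| ^ trunc_log M N)%:R.
Proof.
move=> N0 T0; set k := trunc_log M N; set E := [set _ | _]%SET.
have NR : 0 < N%:R :> R by rewrite ltr0n.
have [_ Nk] := andP (trunc_log_bounds M2 N0).
pose near y := [set j : 'I_N | `|j%:R - N%:R * y| < T + M%:R]%SET.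
have cover j : j \in E -> has (fun y => j \in near y) (cantor_points k).
  rewrite inE mulrC -ltr_pdivlMr// => /(@cantor_dist_near_points _ _ k)[y yk hy].
  apply/hasP; exists y => //; rewrite inE.
  have -> : j%:R - N%:R * y = N%:R * (j%:R / N%:R - y) by field; rewrite gt_eqF.
  rewrite normrM gtr0_norm// mulrC -ltr_pdivlMr//; apply: lt_le_trans hy _.
  rewrite mulrDl lerD2l ler_pdivlMr// mulrC ler_pdivrMr ?exprn_gt0//.
  by rewrite -natrX -natrM ler_nat -expnS ltnW.
rewrite -size_cantor_points.
have -> : (2 * (T + M%:R) + 1) * (size (cantor_points k))%:R =
    \sum_(y <- cantor_points k) (2 * (T + M%:R) + 1) :> R.
  by rewrite big_const_seq count_predT iter_addr_0 mulr_natr.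
apply: (@le_trans _ _ (\sum_(y <- cantor_points k) #|near y|%:R)); last first.
  by apply: ler_sum => y _; apply: card_ord_near; rewrite addr_ge0.
rewrite -natr_sum ler_nat -sum1_card.
apply: (@leq_trans (\sum_(j in E) \sum_(y <- cantor_points k) (j \in near y))%N).
  apply: leq_sum => j /cover /hasP[y yk jy].
  by rewrite (big_rem y)//= jy.
rewrite exchange_big /=; apply: leq_sum => y _.
rewrite -sum1_card [leqRHS]big_mkcond /= big_mkcond /=; apply: leq_sum => j _.
by case: ifP => //; case: ifP.
Qed.

(** As [#|A|] is [M] to the power [d], the left side is [M ^ k] to the power [d], and
    [M ^ k <= N]. *)
Lemma cantor_card_powR (N : nat) : (0 < N)%N ->
  (#|A| ^ trunc_log M N)%:R <= N%:R `^ (ln (#|A|%:R : R) / ln (M%:R : R)).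
Proof.
move=> N0; set k := trunc_log M N; set d := _ / _.
have AR : 0 < #|A|%:R :> R by rewrite ltr0n.
have lM : 0 < ln (M%:R : R) by rewrite ln_gt0// ltr1n.
have /andP[kN _] := trunc_log_bounds M2 N0.
have d0 : 0 <= d by rewrite divr_ge0 ?(ltW lM)// ln_ge0// ler1n.
have AE : #|A|%:R = M%:R `^ d.
  by rewrite /powR gt_eqF// /d divfK ?gt_eqF// lnK.
rewrite natrX AE -powR_mulrn ?powR_ge0// powRAC powR_mulrn ?(ltW M0)//.
by rewrite ge0_ler_powR ?nnegrE ?exprn_ge0// -natrX ler_nat.
Qed.

End CantorSet.

(** * Entries of the baker matrix *)

Section BakerKernel.
Local Open Scope classical_set_scope.
Context {R : realType}.
Local Notation C := R[i].

Lemma cexpD (x y : R) : cexp (x + y) = cexp x * cexp y.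
Proof.
by apply/eqP; rewrite eq_complex /= cosD sinD eqxx /= addrC eqxx.
Qed.

Lemma cexp_natmul (x : R) m : cexp (m%:R * x) = cexp x ^+ m.
Proof.
elim: m => [|m IHm]; last by rewrite exprS -IHm -cexpD -natr1 mulrDl mul1r addrC.
by rewrite mul0r expr0 /cexp cos0 sin0.
Qed.

Lemma conjc_cexp (x : R) : conjc (cexp x) = cexp (- x).
Proof. by rewrite /cexp /= cosN sinN. Qed.

Lemma conjcM (x y : C) : conjc (x * y) = conjc x * conjc y.
Proof. exact: rmorphM. Qed.

Lemma conjc_rC (x : R) : conjc (rC x) = rC x.
Proof. by rewrite /= oppr0. Qed.

Lemma mulmx_proj_a (n K M : nat) (K0 : (0 < K)%N) (a : 'I_M) (X : 'M[C]_(n, K))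
    (i : 'I_n) (j : 'I_(K * M)) :
  (X *m proj_a R K a) i j =
  if (j %/ K == a)%N then X i (Ordinal (ltn_pmod j K0)) else 0.
Proof.
rewrite mxE; case: eqP => [ja|ja].
  rewrite (bigD1 (Ordinal (ltn_pmod j K0)))//= big1 => [|l neq]; rewrite !mxE /=.
    by rewrite -ja addnC -divn_eq eqxx mulr1 addr0.
  case: eqP => [e|_]; rewrite ?mulr0//.
  case/negP: neq; rewrite -val_eqE /= e addnC modnMDl modn_small//.
rewrite big1// => l _; rewrite mxE; case: eqP => [e|_]; rewrite ?mulr0//.
by case: ja; rewrite e addnC divnMDl// divn_small ?addn0.
Qed.

Lemma proj_a_index_lt (K M : nat) (a : 'I_M) (m : 'I_K) : (m + a * K < K * M)%N.
Proof.
apply: (@leq_trans (K + a * K)); first by rewrite ltn_add2r.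
by rewrite -mulSn mulnC leq_mul2l ltn_ord orbT.
Qed.

Lemma mulmx_adj_proj_a (n K M : nat) (a : 'I_M) (X : 'M[C]_(n, K * M))
    (i : 'I_n) (m : 'I_K) :
  (X *m adjmx (proj_a R K a)) i m = X i (Ordinal (proj_a_index_lt a m)).
Proof.
rewrite mxE (bigD1 (Ordinal (proj_a_index_lt a m)))//= big1 => [|l neq]; rewrite !mxE.
  by rewrite eqxx conjc1 mulr1 addr0.
case: eqP => [e|_]; rewrite ?conjc0 ?mulr0//.
by case/negP: neq; rewrite -val_eqE /= e.
Qed.

(* Writing [j = a K + l], this is [N] times the displacement of [i / N] from the
   image [M (j / N) - a] of [j / N]. *)
Definition baker_shift (K M : nat) (i j : 'I_(K * M)) : R :=
  i%:R - M%:R * (j %% K)%:R.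

(** The phases of the two Fourier matrices at the summation index [m] combine into a factor
    independent of [m] times [z ^+ m]; the normalizations give at most [1 / K]. *)
Lemma normc_baker_term (K M : nat) (K0 : (0 < K)%N) (chi : R -> R) (a : 'I_M)
    (i : 'I_(K * M)) (l : 'I_K) :
  (0 < M)%N ->
  normc ((adjmx (dft R (K * M)) *m adjmx (proj_a R K a) *m cutoff chi K *m dft R K
        *m cutoff chi K) i l) <=
  `|chi (l%:R / K%:R)| / K%:R *
   normc (\sum_(m < K) rC (chi (m%:R / K%:R)) *
     cexp (2 * pi * (i%:R - M%:R * l%:R) / (K * M)%:R) ^+ m).
Proof.
move=> M0; have KR : 0 < K%:R :> R by rewrite ltr0n.
have MR : 0 < M%:R :> R by rewrite ltr0n.
set z := cexp _; set S := \sum_(m < K) _.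
pose s : R := (Num.sqrt (K * M)%:R)^-1 * (Num.sqrt K%:R)^-1.
rewrite mul_mx_diag !mxE.
have -> : \sum_j (adjmx (dft R (K * M)) *m adjmx (proj_a R K a)
      *m cutoff chi K) i j * dft R K j l =
    rC s * cexp (2 * pi * a%:R * i%:R / M%:R) * S.
  rewrite mulr_sumr; apply: eq_bigr => m _.
  rewrite mul_mx_diag mxE mulmx_adj_proj_a !mxE conjcM conjc_cexp.
  rewrite conjc_rC /z -cexp_natmul /s rCM /=.
  set u := rC _; set v := rC _; set w := rC _; set e := cexp _; set f := cexp _.
  have -> : u * e * v * (w * f) = u * w * v * (e * f) by ring.
  set e' := cexp _; set f' := cexp _.
  have -> : u * w * e' * (v * f') = u * w * v * (e' * f') by ring.
  rewrite /e /f /e' /f' -!cexpD; congr (_ * cexp _).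
  by rewrite !natrM natrD natrM opprK; field; rewrite !gt_eqF.
rewrite !normcM normc_cexp !normc_rC mulr1.
have s0 : 0 <= s by rewrite mulr_ge0 ?invr_ge0 ?sqrtr_ge0.
have sK : s <= K%:R^-1.
  rewrite /s -invfM lef_pV2 ?posrE ?mulr_gt0 ?sqrtr_gt0 ?ltr0n ?muln_gt0 ?K0//.
  rewrite -[leLHS]sqr_sqrtr ?ler0n// expr2 ler_wpM2r ?sqrtr_ge0// ler_wsqrtr//.
  by rewrite ler_nat leq_pmulr.
rewrite ger0_norm// mulrC -mulrA ler_wpM2l//.
by rewrite ler_wpM2r// normc_ge0.
Qed.

(** Column [j] is seen only by the projection with [a = j %/ K], so at most one term survives. *)
Lemma baker_entry (K M : nat) (K0 : (0 < K)%N) (A : {set 'I_M}) (chi : R -> R)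
    (i j : 'I_(K * M)) :
  (exists2 a : 'I_M, a \in A /\ (j %/ K = a)%N & baker K A chi i j =
   (adjmx (dft R (K * M)) *m adjmx (proj_a R K a) *m cutoff chi K *m dft R K
        *m cutoff chi K) i (Ordinal (ltn_pmod j K0))) \/
  baker K A chi i j = 0.
Proof.
rewrite /baker summxE; under eq_bigr do rewrite (mulmx_proj_a K0).
have aM : (j %/ K < M)%N by rewrite ltn_divLR// [(M * K)%N]mulnC.
have [aA|aA] := boolP (Ordinal aM \in A).
  left; exists (Ordinal aM) => //; rewrite (bigD1 (Ordinal aM))//= eqxx.
  rewrite big1 ?addr0// => a /andP[_ neq]; case: eqP => // e.
  by case/negP: neq; rewrite -val_eqE /= e.
right; rewrite big1// => a aA'; case: eqP => // e.
by case/negP: aA; rewrite (_ : Ordinal aM = a)//; exact: val_inj.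
Qed.

Lemma baker_decay (M : nat) (A : {set 'I_M}) (chi : R -> R) (L : nat) :
  (0 < M)%N -> smooth chi -> compact_support_01 chi ->
  (forall x, 0 <= chi x <= 1) ->
  exists2 B : R, 0 <= B & forall (K : nat) (i j : 'I_(K * M)), (0 < K)%N ->
    normc (baker K A chi i j) * (1 + `|baker_shift i j|) ^+ L <= B.
Proof.
move=> M0 schi cchi chi1; have [a [b [a0 ab b1 chi0]]] := cchi.
(* The margin lies below both [a] and [1 - b]: with [x] in [[a, b]] and [i / N] in [[0, 1]], it
   bounds [|i / N - x|] away from 1. *)
have c01 : 0 < a * (1 - b) < 1 by apply/andP; split; nra.
have [B B0 hB] := exp_sum_decay L schi cchi M0 c01.
exists B => // K i j K0; have KR : 0 < K%:R :> R by rewrite ltr0n.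
have MR : 0 < M%:R :> R by rewrite ltr0n.
have [[d _ ->]|->] := baker_entry K0 A chi i j; last by rewrite normc0 mul0r.
have t0 : 0 <= (1 + `|baker_shift i j|) ^+ L by rewrite exprn_ge0 ?addr_ge0.
have hn := normc_baker_term K0 chi d i (Ordinal (ltn_pmod j K0)) M0.
apply: le_trans (ler_wpM2r t0 hn) _; rewrite /=.
rewrite -/(baker_shift i j).
set x := _ / K%:R.
have [->|cx] := eqVneq (chi x) 0; first by rewrite normr0 !mul0r.
have /andP[ax xb] : a <= x <= b.
  apply/andP; split; rewrite leNgt; apply: contra cx => h; rewrite chi0//.
  - by left.
  - by right.
have t_le : `|baker_shift i j| <= (1 - a * (1 - b)) * (K * M)%:R.
  have NE : M%:R * (j %% K)%:R = (K * M)%:R * x.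
    by rewrite /x natrM; field; rewrite gt_eqF.
  have iN : i%:R <= (K * M)%:R :> R by rewrite ler_nat ltnW.
  have i0 : 0 <= i%:R :> R by [].
  have N0 : 0 <= (K * M)%:R :> R by [].
  have h1 : (K * M)%:R * (a * (1 - b)) <= (K * M)%:R * x by rewrite ler_wpM2l//; nra.
  have h2 : (K * M)%:R * x <= (K * M)%:R * (1 - a * (1 - b)).
    by rewrite ler_wpM2l//; nra.
  by rewrite /baker_shift NE ler_norml; apply/andP; split; lra.
have h := hB K _ K0 t_le.
have /andP[cx0 cx1] := chi1 x.
set S := normc _ in h *.
have S0 : 0 <= S * (1 + `|baker_shift i j|) ^+ L by rewrite mulr_ge0// normc_ge0.
rewrite ger0_norm// -!mulrA; apply: (@le_trans _ _ (1 * (K%:R^-1 * (B * K%:R)))).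
  apply: ler_pM => //; first by rewrite mulr_ge0// invr_ge0.
  by rewrite ler_wpM2l// invr_ge0.
by rewrite mul1r mulrC mulfK// gt_eqF.
Qed.

End BakerKernel.

(** * Kernel sums and elementary inequalities *)

Section KernelSums.
Local Open Scope classical_set_scope.
Context {R : realType}.

Lemma sum_inv_sqr_le2 n : \sum_(m < n) (1 + m%:R) ^- 2 <= 2 :> R.
Proof.
(* The sharper bound makes the induction work: [(x + 2) ^- 2] is at most
   [1 / (x + 1) - 1 / (x + 2)]. *)
have H k : \sum_(m < k.+1) (1 + m%:R) ^- 2 <= 2 - (1 + k%:R)^-1 :> R.
  elim: k => [|k IHk]; first by rewrite big_ord1 addr0 expr1n invr1; lra.
  rewrite big_ord_recr /=; apply: le_trans (lerD IHk (lexx _)) _.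
  rewrite -[k.+1%:R]natr1; have := ler0n R k; move: (k%:R) => x x0.
  rewrite -subr_ge0.
  have -> : 2 - (1 + (x + 1))^-1 - (2 - (1 + x)^-1 + (1 + (x + 1)) ^- 2) =
     ((1 + x) * (1 + (x + 1)) ^+ 2)^-1.
    field; apply/andP; split; apply/eqP; lra.
  by rewrite invr_ge0 mulr_ge0 ?exprn_ge0//; lra.
case: n => [|n]; first by rewrite big_ord0.
apply: le_trans (H n) _; rewrite gerBl invr_ge0 addr_ge0//.
Qed.

Lemma sum_inv_sqr_dist_le4 n (p : nat) :
  \sum_(i < n) (1 + `|i%:R - p%:R|) ^- 2 <= 4 :> R.
Proof.
pose f m : R := (1 + m%:R) ^- 2.
have f0 m : 0 <= f m by rewrite invr_ge0 exprn_ge0// addr_ge0.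
(* The first sum covers the indices from [p] on, the second those below [p]; the induction shifts
   [i] and [p] together. *)
have H : \sum_(i < n) (1 + `|i%:R - p%:R|) ^- 2 <=
    \sum_(m < n) f m + \sum_(m < p) f m.+1.
  elim: p n => [|p IHp] [|n].
  - by rewrite !big_ord0 addr0.
  - rewrite [X in _ <= _ + X]big_ord0 addr0; apply: ler_sum => i _.
    by rewrite subr0 ger0_norm.
  - by rewrite !big_ord0 add0r sumr_ge0.
  - rewrite big_ord_recl /= sub0r normrN ger0_norm// [X in _ <= _ + X]big_ord_recr /=.
    rewrite [X in _ <= X + _]big_ord_recr /=.
    rewrite -/(f p.+1) [leLHS]addrC [leRHS]addrA lerD2r.
    apply: (@le_trans _ _ (\sum_(i < n) f i + \sum_(i < p) f i.+1)).
      apply: le_trans (IHp n); apply: ler_sum => i _.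
      by rewrite /bump leq0n add1n -!natr1 opprD addrACA subrr addr0.
    by rewrite lerD2r lerDl.
apply: le_trans H _; rewrite (_ : 4 = 2 + 2 :> R); last by ring.
apply: lerD; first exact: sum_inv_sqr_le2.
apply: le_trans (sum_inv_sqr_le2 p.+1); rewrite big_ord_recl /=.
by rewrite ler_wpDl ?f0.
Qed.

Lemma sum_modn (K M : nat) (f : nat -> R) :
  \sum_(j < K * M) f (j %% K)%N = M%:R * \sum_(l < K) f l.
Proof.
rewrite -(big_mkord xpredT (fun j => f (j %% K)%N)).
elim: M => [|M IHM]; first by rewrite muln0 big_geq// mul0r.
rewrite mulnS (@big_cat_nat _ _ _ K) ?leq_addr//= -natr1 mulrDl mul1r addrC.
congr (_ + _); last first.
  by rewrite big_mkord; apply: eq_bigr => l _; rewrite modn_small.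
rewrite -IHM -{1}[K]add0n big_addn addKn; apply: eq_bigr => j _.
by rewrite modnDr.
Qed.

Lemma dist_divn_le (i l M : nat) : (0 < M)%N ->
  `|l%:R - (i %/ M)%:R| <= `|i%:R - M%:R * l%:R| :> R.
Proof.
move=> M0; have MR : 1 <= M%:R :> R by rewrite ler1n.
have rM : (i %% M)%:R + 1 <= M%:R :> R by rewrite natr1 ler_nat ltn_pmod.
have r0 : 0 <= (i %% M)%:R :> R by [].
have -> : i%:R = (i %/ M)%:R * M%:R + (i %% M)%:R :> R.
  by rewrite -natrM -natrD -divn_eq.
have [lq|ql] := leqP l (i %/ M).
  have h : l%:R <= (i %/ M)%:R :> R by rewrite ler_nat.
  by rewrite ler0_norm ?subr_le0// ger0_norm; nra.
have h : (i %/ M)%:R + 1 <= l%:R :> R by rewrite natr1 ler_nat.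
rewrite ger0_norm; last lra.
by rewrite ler0_norm; nra.
Qed.

(** In the binomial expansion, [T ^- k <= T^-1] for [k >= 1]. The induction uses the form with
    [(1 + t) ^+ s - 1]. *)
Lemma expr_1Dratio_le (t T : R) (s : nat) : 0 <= t -> 1 <= T ->
  (1 + t / T) ^+ s <= 1 + (1 + t) ^+ s / T.
Proof.
move=> t0 T1; have T0 : 0 < T by lra.
suff : (1 + t / T) ^+ s <= 1 + ((1 + t) ^+ s - 1) / T.
  move=> /le_trans; apply; rewrite lerD2l ler_pM2r ?invr_gt0//; lra.
elim: s => [|s IHs]; first by rewrite !expr0 subrr mul0r addr0.
rewrite !exprS; have P1 : 1 <= (1 + t) ^+ s by rewrite exprn_ege1// lerDl.
have tT : 0 <= t / T by rewrite divr_ge0// ltW.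
apply: le_trans (ler_wpM2l _ IHs) _; first by rewrite addr_ge0.
move: ((1 + t) ^+ s) P1 => P P1; rewrite -subr_ge0.
have -> : 1 + ((1 + t) * P - 1) / T - (1 + t / T) * (1 + (P - 1) / T) =
    t * (P - 1) * (T - 1) / T ^+ 2 by field; rewrite gt_eqF.
rewrite divr_ge0 ?exprn_ge0 ?(ltW T0)// mulr_ge0 ?subr_ge0// mulr_ge0 ?subr_ge0//.
Qed.

Lemma exists_expr_le (x e c : R) : 0 <= x < 1 -> 0 < e -> 0 < c ->
  exists s, c * x ^+ s <= e.
Proof.
move=> /andP[x0 x1] e0 c0.
have h : (x ^+ s) @[s --> \oo] --> (0 : R) by apply: cvg_expr; rewrite ger0_norm.
have /cvgrPdist_le /(_ (e / c) (divr_gt0 e0 c0)) [N _ /(_ N (leqnn N)) /=] := h.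
rewrite sub0r normrN ger0_norm ?exprn_ge0// => hN; exists N.
by rewrite mulrC -ler_pdivlMr.
Qed.

End KernelSums.

(** * Conjugation by the weights *)

Section WeightedBaker.
Local Open Scope classical_set_scope.
Context {R : realType} (M : nat) (A : {set 'I_M}).
Hypothesis M2 : (2 <= M)%N.
Hypothesis A0 : (0 < #|A|)%N.

Definition scaled_dist (K : nat) (j : 'I_(K * M)) : R :=
  (K * M)%:R * cantor_dist A (j%:R / (K * M)%:R).

Lemma scaled_dist_ge0 K (j : 'I_(K * M)) : 0 <= scaled_dist j.
Proof. by rewrite mulr_ge0// cantor_dist_ge0. Qed.

(** Here [j / N = (a + x) / M], so the Cantor distance at [x] dominates; passing from [x] to [i / N]
    costs [N |i / N - x|], which is the shift. *)
Lemma scaled_dist_expand (K : nat) (i j : 'I_(K * M)) (a : 'I_M) :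
  (0 < K)%N -> a \in A -> (j %/ K = a)%N ->
  M%:R * scaled_dist j <= scaled_dist i + `|baker_shift i j|.
Proof.
move=> K0 aA ja; have KR : 0 < K%:R :> R by rewrite ltr0n.
have MR : 0 < M%:R :> R by rewrite ltr0n; lia.
have NR : 0 < (K * M)%:R :> R by rewrite natrM mulr_gt0.
set x : R := (j %% K)%:R / K%:R.
have jE : j%:R / (K * M)%:R = (a%:R + x) / M%:R.
  rewrite {1}(divn_eq j K) ja natrD !natrM /x; field; by rewrite !gt_eqF.
rewrite /scaled_dist jE mulrCA.
apply: le_trans (ler_wpM2l (ltW NR) (cantor_dist_shift M2 A0 _ aA)) _.
apply: le_trans (ler_wpM2l (ltW NR) (cantor_dist_lip M2 A0 _ (i%:R / (K * M)%:R))) _.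
rewrite mulrDr lerD2l -{1}(gtr0_norm NR) -normrM distrC.
rewrite le_eqVlt; apply/orP; left; apply/eqP; congr `|_|.
by rewrite /baker_shift /x natrM; field; rewrite !gt_eqF.
Qed.

(** Since [M >= 2], [2 Dj <= Di + t]; after cancellation the claim is
    [T (T + 2 Dj) <= (T + t) (T + Di)]. *)
Lemma weight_ratio_le (Di Dj t T : R) : 0 <= Di -> 0 <= Dj -> 0 <= t -> 1 <= T ->
  M%:R * Dj <= Di + t ->
  (T + Dj) / (T + Di) <= (1 + t / T) * ((T + Dj) / (T + 2 * Dj)).
Proof.
move=> Di0 Dj0 t0 T1 h.
have MR : 2 <= M%:R :> R by rewrite ler_nat.
have h' : 2 * Dj <= Di + t by nra.
have -> : (1 + t / T) * ((T + Dj) / (T + 2 * Dj)) =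
   (T + Dj) * ((T + t) / (T * (T + 2 * Dj))).
  by field; rewrite !gt_eqF//; lra.
rewrite ler_wpM2l//; first lra.
rewrite -[leLHS]mul1r ler_pdivlMr ?mulr_gt0//; last 2 first.
- lra.
- lra.
rewrite mul1r mulrC ler_pdivrMr; last lra.
nra.
Qed.

Lemma count_eig_cantor (chi : R -> R) (q : R) :
  smooth chi -> compact_support_01 chi -> (forall x : R, 0 <= chi x <= 1) ->
  0 < q ->
  exists T B : R, [/\ 0 <= T, 0 <= B & forall K, (0 < K)%N ->
   (count (fun z : R[i] => rC q <= `|z|) (eigenvalues (baker K A chi)))%:R
     <= B * #|[set j : 'I_(K * M) | scaled_dist j < T]%SET|%:R].
Proof.
move=> schi cchi chi1 q0; have M0 : (0 < M)%N by lia.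
have MR : 0 < M%:R :> R by rewrite ltr0n.
have [B2 B20 hB2] := baker_decay A 2 M0 schi cchi chi1.
(* [B2] bounds the unweighted part of a conjugated entry, and 1 bounds the part divided by [T]. *)
pose c := B2 + 1.
have c0 : 0 < c by rewrite /c; lra.
(* Column and row sums of [G]; a row meets every residue modulo [K] exactly [M] times. *)
pose a := 4 * c; pose b := M%:R * 4 * c.
have a0 : 0 < a by rewrite /a mulr_gt0.
have b0 : 0 < b by rewrite /b !mulr_gt0.
(* The order matters: [a] and [b] do not depend on [s], so [s] is fixed first and [T] is then chosen
   in terms of [s]. *)
have [s hs] : exists s, a * b * ((2 / 3) ^+ 2) ^+ s <= q ^+ 2 / 2.
  apply: exists_expr_le; rewrite ?mulr_gt0 ?exprn_gt0 ?invr_gt0//.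
  by apply/andP; split; lra.
have [Bs Bs0 hBs] := baker_decay A (s + 2) M0 schi cchi chi1.
pose T := 1 + Bs.
have T1 : 1 <= T by rewrite /T; lra.
have q20 : 0 < q ^+ 2 / 2 by rewrite divr_gt0 ?exprn_gt0.
exists T, (a * b / (q ^+ 2 / 2)); split; first by lra.
  by rewrite ltW// divr_gt0// mulr_gt0.
move=> K K0; rewrite mulrAC ler_pdivlMr//.
pose w (j : 'I_(K * M)) : R := (T + scaled_dist j) ^+ s.
have w0 j : 0 < w j by rewrite exprn_gt0// ltr_pwDl ?scaled_dist_ge0//; lra.
pose W := diag_mx (\row_j rC (w j)) : 'M[R[i]]_(K * M).
pose V := diag_mx (\row_j rC (w j)^-1) : 'M[R[i]]_(K * M).
have VW : V *m W = 1%:M.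
  rewrite mulmx_diag -diag_const_mx; congr diag_mx; apply/rowP => j.
  by rewrite !mxE -rCM mulVf// gt_eqF.
rewrite -(eigenvalues_conj (baker K A chi) VW).
pose rho (j : 'I_(K * M)) : R := (T + scaled_dist j) / (T + 2 * scaled_dist j).
have rho01 j : 0 <= rho j <= 1.
  have := scaled_dist_ge0 j; rewrite /rho => d0; apply/andP; split.
    by rewrite divr_ge0//; lra.
  by rewrite ler_pdivrMr ?mul1r; lra.
pose G (i j : 'I_(K * M)) : R := c * (1 + `|baker_shift i j|) ^- 2.
have shift0 (i j : 'I_(K * M)) : 0 < 1 + `|baker_shift i j| :> R.
  by rewrite ltr_pwDl.
apply: (@count_eigenvalues_le _ _ _ G (fun j => rho j ^+ s)).
- by move=> i j; rewrite mulr_ge0 ?(ltW c0)// invr_ge0 exprn_ge0// ltW.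
- move=> i j; rewrite mul_mx_diag mul_diag_mx !mxE !normcM !normc_rC.
  rewrite !gtr0_norm ?invr_gt0//.
  have [[e [eA je] _]|->] := baker_entry K0 A chi i j; last first.
    rewrite normc0 mulr0 mul0r mulr_ge0 ?exprn_ge0//; last by case/andP: (rho01 j).
    by rewrite mulr_ge0 ?(ltW c0)// invr_ge0 exprn_ge0// ltW.
  have hr := weight_ratio_le (scaled_dist_ge0 i) (scaled_dist_ge0 j)
    (normr_ge0 (baker_shift i j)) T1 (scaled_dist_expand _ K0 eA je).
  rewrite -/(rho j) in hr.
  set t := `|baker_shift i j| in hr *.
  have t0 : 0 <= t by exact: normr_ge0.
  set n := normc _.
  have n0 : 0 <= n by exact: normc_ge0.
  have -> : (w i)^-1 * n * w j = n * ((T + scaled_dist j) / (T + scaled_dist i)) ^+ s.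
    by rewrite /w expr_div_n; ring.
  apply: (@le_trans _ _ (n * ((1 + t / T) ^+ s * rho j ^+ s))).
    rewrite ler_wpM2l// -exprMn lerXn2r ?nnegrE//.
      by rewrite divr_ge0 ?addr_ge0 ?scaled_dist_ge0//; lra.
    rewrite mulr_ge0//; last by case/andP: (rho01 j).
    by rewrite addr_ge0// divr_ge0//; lra.
  rewrite mulrA ler_wpM2r ?exprn_ge0//; first by case/andP: (rho01 j).
  apply: le_trans (ler_wpM2l n0 (expr_1Dratio_le s t0 T1)) _.
  rewrite /G -/t ler_pdivlMr ?exprn_gt0//; last exact: shift0.
  have h2 := hB2 K i j K0; have hS := hBs K i j K0.
  rewrite -/n -/t in h2 hS.
  have -> : n * (1 + (1 + t) ^+ s / T) * (1 + t) ^+ 2 =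
     n * (1 + t) ^+ 2 + n * (1 + t) ^+ (s + 2) / T.
    by rewrite exprD; ring.
  rewrite /c lerD// ler_pdivrMr ?mul1r//; last by lra.
  by apply: le_trans hS _; rewrite /T lerDr.
(* For fixed [j] the centre [M (j %% K)] is an integer. *)
- move=> j; rewrite -mulr_sumr /a [4 * c]mulrC ler_wpM2l ?(ltW c0)//.
  under eq_bigr do rewrite /baker_shift -natrM.
  exact: sum_inv_sqr_dist_le4.
- move=> i; rewrite -mulr_sumr /b [_ * c]mulrC ler_wpM2l ?(ltW c0)//.
  rewrite (sum_modn K M (fun l => (1 + `|i%:R - M%:R * l%:R|) ^- 2)).
  rewrite ler_wpM2l//; apply: le_trans (sum_inv_sqr_dist_le4 K (i %/ M)).
  apply: ler_sum => l _; rewrite lef_pV2 ?posrE ?exprn_gt0 ?ltr_pwDl//.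
  by rewrite lerXn2r ?nnegrE ?addr_ge0// lerD2l dist_divn_le.
- exact: ltW.
- exact: ltW.
- by move=> j; have /andP[? ?] := rho01 j; rewrite exprn_ge0//= exprn_ile1.
(* The ratio [(T + D) / (T + 2 D)] is at most [2 / 3] exactly when [T <= D]. *)
- move=> j; rewrite inE -leNgt => Tj; apply: le_trans hs.
  rewrite ler_pM2l ?mulr_gt0// -!exprM mulnC exprM [leRHS]exprM.
  have /andP[r0 _] := rho01 j.
  rewrite lerXn2r ?nnegrE ?exprn_ge0// ?divr_ge0// lerXn2r ?nnegrE// ?divr_ge0//.
  by rewrite /rho ler_pdivrMr; lra.
- exact: ltW.
Qed.

End WeightedBaker.

Theorem theorem1 (R : realType) (M : nat) (A : {set 'I_M}) (chi : R -> R) :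
  (2 <= M)%N -> (0 < #|A|)%N ->
  smooth chi -> compact_support_01 chi -> (forall x : R, 0 <= chi x <= 1) ->
  forall nu : R, 0 < nu ->
  exists (Cst : R) (K0 : nat), forall K : nat, (K0 <= K)%N ->
    (count_eig K A chi nu)%:R
      <= Cst * ((K * M)%N%:R) `^ (ln (#|A|%:R : R) / ln (M%:R : R)).
Proof.
move=> M2 A0 schi cchi chi1 nu _.
have q0 : 0 < M%:R `^ (- nu) :> R by rewrite powR_gt0// ltr0n; lia.
have [T [B [T0 B0 hcount]]] := count_eig_cantor M2 A0 schi cchi chi1 q0.
exists (B * (2 * (T + M%:R) + 1)), 1%N => K K0.
apply: le_trans (hcount K K0) _; rewrite -mulrA ler_wpM2l//.
have N0 : (0 < K * M)%N by rewrite muln_gt0 K0; lia.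
apply: le_trans (card_cantor_neighborhood M2 A0 N0 T0) _.
rewrite ler_wpM2l ?cantor_card_powR//.
by rewrite addr_ge0// mulr_ge0// addr_ge0.
Qed.
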